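(* The following bounds on the communication cost in the direction $C\to AB$ hold: [ES] every ES-box has $\mathrm{CC}\ge 2$; [2EPR-GHZ] every 2EPR-GHZ box has $\mathrm{CC}\ge 1$; [GHZ-EPR] every GHZ-EPR box has $\mathrm{CC}\ge 1$.
   Context: Three parties: Alice ($A$), Bob ($B$), Charlie ($C$). Notation: $|\Psi^+\rangle_{XY}=\frac1{\sqrt2}(|00\rangle+|11\rangle)$ (EPR pair of two qubits), $|GHZ\rangle_{ABC}=\frac1{\sqrt2}(|000\rangle+|111\rangle)$. A tripartite LOCC operation $\Lambda_{ABC}$ is a quantum channel (completely positive trace-preserving map) implemented by Alice, Bob and Charlie by rounds of local quantum operations and classical communication among them, with no pre-shared entanglement. Alice's and Bob's systems are qubits both at input and at output. An LOCC operation is called: - an ES-box (entanglement swapping) if Charlie's input system consists of two qubits $C=C_1C_2$ and the input $|\Psi^+\rangle_{AC_1}|\Psi^+\rangle_{BC_2}$ is mapped to the output $|\Psi^+\rangle_{AB}$; - a 2EPR-GHZ box if Charlie's input system consists of two qubits $C=C_1C_2$ and the input $|\Psi^+\rangle_{AC_1}|\Psi^+\rangle_{BC_2}$ is mapped to the output $|GHZ\rangle_{ABC}$; - a GHZ-EPR box if Charlie's input system is one qubit and the input $|GHZ\rangle_{ABC}$ is mapped to the output $|\Psi^+\rangle_{AB}$. For ES- and GHZ-EPR boxes only the $AB$ output is considered: Charlie's output system is traced out. No requirement is made on the action of the box on other inputs. Communication cost (CC) of a box $\Lambda$, in the direction $C\to AB$: the rate (number of classical bits per use of the box, in the asymptotic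 setting of many uses) at which classical communication must be sent from Charlie to Alice and Bob in order to implement the box. That is, it is the infimum of the numbers $R$ such that for all sufficiently large $n$ there is an LOCC protocol, using no pre-shared entanglement among those implementing it, which realizes $\Lambda^{\otimes n}$ on every possible input and in which at most $nR$ classical bits are sent from Charlie to Alice and Bob. Only communication from Charlie to Alice and Bob is counted. *)

(* Defs.v *)
From mathcomp Require Import all_boot all_order all_algebra.
From mathcomp Require Import complex.
From mathcomp Require Import classical_sets reals constructive_ereal ereal.
Set Implicit Arguments.
Unset Strict Implicit.
Unset Printing Implicit Defensive.
Import Order.TTheory GRing.Theory Num.Theory.
Local Open Scope ring_scope.
Local Open Scope sesquilinear_scope.

(* The Hilbert space of a system is C^X, where the finite type X labels its
   computational basis; a composite system is labelled by a product type.
   Kets and operators are MathComp matrices of size #|X|, entries being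
   accessed by basis labels through [enum_rank] and [enum_val]. *)
Notation ket R X := ('cV[R[i]]_#|{: X}|).
Notation op R X := ('M[R[i]]_#|{: X}|).
Notation qubit := bool.
Notation copies n X := {ffun 'I_n -> X}.

Section Operators.
Variable R : realType.
Implicit Types X Y A B C : finType.

Definition mkket X (f : X -> R[i]) : ket R X := \col_i f (enum_val i).

Definition mkop X (f : X -> X -> R[i]) : op R X :=
  \matrix_(i, j) f (enum_val i) (enum_val j).

Definition entry X (rho : op R X) (x x' : X) : R[i] :=
  rho (enum_rank x) (enum_rank x').

(* |psi><psi| *)
Definition proj X (psi : ket R X) : op R X := psi *m psi ^t*.

(* |x><x'| *)
Definition unit_op X (x x' : X) : op R X :=
  delta_mx (enum_rank x) (enum_rank x').

(* In the order of R[i], [0 <= z] also says that z is real, so that a psd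
   matrix is Hermitian. *)
Definition psd n (M : 'M[R[i]]_n) : Prop :=
  forall v : 'cV[R[i]]_n, 0 <= (v ^t* *m M *m v) 0 0.

(* (Phi (x) id) rho, computed on the blocks <k|rho|k'> of rho *)
Definition ampliate X Y (Phi : op R X -> op R Y) (K : finType)
    (rho : op R (X * K)%type) : op R (Y * K)%type :=
  mkop (fun y y' : Y * K =>
    entry (Phi (mkop (fun x x' => entry rho (x, y.2) (x', y'.2)))) y.1 y'.1).

Definition completely_positive X Y (Phi : {linear op R X -> op R Y}) : Prop :=
  forall (k : nat) (rho : op R (X * 'I_k)%type),
    psd rho -> psd (ampliate Phi rho).

Definition instrument X (M : finType) (Y : M -> finType)
    (E : forall m, {linear op R X -> op R (Y m)}) : Prop :=
  (forall m, completely_positive (E m)) /\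
  (forall rho, \sum_m \tr (E m rho) = \tr rho).

(* Phi acting on the system of one of the three parties *)
Definition on_A A B C A' (Phi : op R A -> op R A')
    (rho : op R (A * B * C)%type) : op R (A' * B * C)%type :=
  mkop (fun '(a, b, c) '(a', b', c') =>
    entry (Phi (mkop (fun x x' => entry rho (x, b, c) (x', b', c')))) a a').

Definition on_B A B C B' (Phi : op R B -> op R B')
    (rho : op R (A * B * C)%type) : op R (A * B' * C)%type :=
  mkop (fun '(a, b, c) '(a', b', c') =>
    entry (Phi (mkop (fun x x' => entry rho (a, x, c) (a', x', c')))) b b').

Definition on_C A B C C' (Phi : op R C -> op R C')
    (rho : op R (A * B * C)%type) : op R (A * B * C')%type :=
  mkop (fun '(a, b, c) '(a', b', c') =>
    entry (Phi (mkop (fun x x' => entry rho (a, b, x) (a', b', x')))) c c').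

Definition map3 A B C A' B' C' : Type :=
  op R (A * B * C)%type -> op R (A' * B' * C')%type.

(* Partial trace over Charlie's system, which becomes the trivial system *)
Definition discard_C A B C (rho : op R (A * B * C)%type) :
    op R (A * B * unit)%type :=
  mkop (fun '(a, b, _) '(a', b', _) =>
    \sum_(c : C) entry rho (a, b, c) (a', b', c)).

Definition AB_output A B C A' B' C' (L : map3 A B C A' B' C') :
    map3 A B C A' B' unit :=
  fun rho => discard_C (L rho).

End Operators.

Section Protocols.
Variable R : realType.

(* LOCC protocols as trees.  [protocol A' B' C' A B C] takes the systems
   A, B, C now held by the parties to the output systems A', B', C'.  At each
   node, one party applies an instrument to the whole of its system and
   announces the outcome m to the two others; the rest of the protocol may
   depend on m.  An outcome that a party keeps private is part of the (quantum)
   memory [Y m] that it retains.  Charlie's announcements are strings of k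
   bits (k = 0 is a local operation without communication); the alphabets of
   Alice and Bob are unrestricted. *)
Inductive protocol (A' B' C' : finType) :
    finType -> finType -> finType -> Type :=
| Halt : protocol A' B' C' A' B' C'
| Alice (A B C M : finType) (Y : M -> finType)
    (E : forall m, {linear op R A -> op R (Y m)}) of
    instrument E & (forall m, protocol A' B' C' (Y m) B C) :
    protocol A' B' C' A B C
| Bob (A B C M : finType) (Y : M -> finType)
    (E : forall m, {linear op R B -> op R (Y m)}) of
    instrument E & (forall m, protocol A' B' C' A (Y m) C) :
    protocol A' B' C' A B C
| Charlie (A B C : finType) (k : nat) (Y : k.-tuple bool -> finType)
    (E : forall m, {linear op R C -> op R (Y m)}) of
    instrument E & (forall m, protocol A' B' C' A B (Y m)) :
    protocol A' B' C' A B C.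

(* The map implemented by a protocol, all transcripts being summed over *)
Fixpoint run (A' B' C' A B C : finType) (p : protocol A' B' C' A B C) :
    op R (A * B * C)%type -> op R (A' * B' * C')%type :=
  match p with
  | Halt => fun rho => rho
  | Alice _ _ _ _ _ E _ next => fun rho => \sum_m run (next m) (on_A (E m) rho)
  | Bob _ _ _ _ _ E _ next => fun rho => \sum_m run (next m) (on_B (E m) rho)
  | Charlie _ _ _ _ _ E _ next =>
      fun rho => \sum_m run (next m) (on_C (E m) rho)
  end.

(* The number of bits sent by Charlie, in the worst case over transcripts.  A
   bit counts once although both Alice and Bob receive it: since communication
   between Alice and Bob is free, nothing changes if Charlie sends it to only
   one of them. *)
Fixpoint bits_from_C (A' B' C' A B C : finType) (p : protocol A' B' C' A B C) :
    nat :=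
  match p with
  | Halt => 0
  | Alice _ _ _ _ _ _ _ next => \max_m bits_from_C (next m)
  | Bob _ _ _ _ _ _ _ next => \max_m bits_from_C (next m)
  | Charlie _ _ _ k _ _ _ next => k + \max_m bits_from_C (next m)
  end%N.

Definition implements (A B C A' B' C' : finType)
    (p : protocol A' B' C' A B C) (L : map3 R A B C A' B' C') : Prop :=
  forall rho, run p rho = L rho.

Definition locc (A B C A' B' C' : finType)
    (L : map3 R A B C A' B' C') : Prop :=
  exists p : protocol A' B' C' A B C, implements p L.

Definition nth_copy (A B C : finType) n
    (x : copies n A * copies n B * copies n C) (k : 'I_n) : A * B * C :=
  (x.1.1 k, x.1.2 k, x.2 k).

(* L^{(x) n} for a linear L: the linear map sending (x)_k |x_k><x'_k| to
   (x)_k L(|x_k><x'_k|), the n copies being grouped by party. *)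
Definition tensor_power (A B C A' B' C' : finType) (n : nat)
    (L : map3 R A B C A' B' C')
    (rho : op R (copies n A * copies n B * copies n C)%type) :
    op R (copies n A' * copies n B' * copies n C')%type :=
  mkop (fun y y' =>
    \sum_(x : copies n A * copies n B * copies n C)
    \sum_(x' : copies n A * copies n B * copies n C)
      entry rho x x' *
      \prod_(k < n)
        entry (L (unit_op R (nth_copy x k) (nth_copy x' k)))
              (nth_copy y k) (nth_copy y' k)).

Definition achievable_rate (A B C A' B' C' : finType)
    (L : map3 R A B C A' B' C') (r : R) : Prop :=
  exists N : nat, forall n : nat, (N <= n)%N ->
    exists p : protocol (copies n A') (copies n B') (copies n C')
                        (copies n A) (copies n B) (copies n C),
      implements p (tensor_power L) /\ (bits_from_C p)%:R <= n%:R * r.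

Definition communication_cost (A B C A' B' C' : finType)
    (L : map3 R A B C A' B' C') : \bar R :=
  ereal_inf [set r%:E | r in [set r : R | achievable_rate L r]]%classic.

End Protocols.

Section Boxes.
Variable R : realType.

(* Amplitudes of |Psi^+> and |GHZ> *)
Definition epr (x y : qubit) : R[i] := (x == y)%:R / sqrtC 2.

Definition ghz (x y z : qubit) : R[i] := ((x == y) && (y == z))%:R / sqrtC 2.

(* |Psi^+>_{A C1} |Psi^+>_{B C2} *)
Definition two_epr_ABC : ket R (qubit * qubit * (qubit * qubit))%type :=
  mkket (fun '(a, b, (c1, c2)) => epr a c1 * epr b c2).

Definition ghz_ABC : ket R (qubit * qubit * qubit)%type :=
  mkket (fun '(a, b, c) => ghz a b c).

(* |Psi^+>_{AB}, Charlie holding the trivial system *)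
Definition epr_AB : ket R (qubit * qubit * unit)%type :=
  mkket (fun '(a, b, _) => epr a b).

Definition es_box (C' : finType)
    (L : map3 R qubit qubit (qubit * qubit)%type qubit qubit C') : Prop :=
  locc L /\ AB_output L (proj two_epr_ABC) = proj epr_AB.

Definition two_epr_ghz_box
    (L : map3 R qubit qubit (qubit * qubit)%type qubit qubit qubit) : Prop :=
  locc L /\ L (proj two_epr_ABC) = proj ghz_ABC.

Definition ghz_epr_box (C' : finType)
    (L : map3 R qubit qubit qubit qubit qubit C') : Prop :=
  locc L /\ AB_output L (proj ghz_ABC) = proj epr_AB.

End Boxes.

(* Main.v *)
(* Write d = 2^n and look at n copies.  Unravelling a protocol into Kraus
   operators gives branches t, each consisting of one Kraus operator a_t of
   Alice, one Kraus operator b_t of Bob, and a contractive family c_tj of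
   Charlie; |a| is the Hilbert-Schmidt norm.  Two facts are played against each
   other.
   - If Charlie's k bits were guessed by Alice and Bob, every guess would be a
     trace-preserving protocol between the two of them; hence
     sum_t |a_t u|^2 |b_t v|^2 <= 2^k |u|^2 |v|^2 for all u and v.
   - The output is pure, so every operator of every branch maps the input ket to
     alpha_tj times the output ket.  This ties c_tj to the inverses of a_t and
     b_t, and contractivity bounds the probability s_t = sum_j |alpha_tj|^2 of
     the branch: by |a_t|^2 |b_t|^2 / d^4 for entanglement swapping, by
     |a_t|^2 |b_t|^2 / d^3 for 2EPR -> GHZ, and by
     d^-2 sum_i |a_t e_i|^2 |b_t e_i|^2 for GHZ -> EPR.
   Summing over t, where the s_t add up to 1, gives d^2 <= 2^k for entanglement
   swapping and d <= 2^k in the other two cases. *)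
Require Import Defs.
From HB Require Import structures.
From mathcomp Require Import all_boot all_order all_algebra.
From mathcomp Require Import complex sesquilinear spectral ring zify.
From mathcomp Require Import boolp classical_sets reals constructive_ereal ereal.
Set Implicit Arguments.
Unset Strict Implicit.
Unset Printing Implicit Defensive.
Import Order.TTheory GRing.Theory Num.Theory.
Local Open Scope ring_scope.

(** * Positive matrices and the Hilbert-Schmidt norm *)

Section PositiveMatrices.
Local Open Scope sesquilinear_scope.
Variable C : numClosedFieldType.

(** Polarisation: evaluating at [u + v] makes the form antisymmetric. Replacing [v] by ['i *: v],
    whose scalar comes out conjugated from one slot only, then forces it to vanish. *)
Lemma form_eq0 n (S : 'M[C]_n) :
  (forall v : 'cV_n, (v ^t* *m S *m v) 0 0 = 0) -> S = 0.
Proof.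
move=> S0; pose f (u v : 'cV_n) := (u ^t* *m S *m v) 0 0.
have f0 v : f v v = 0 by exact: S0.
have fDl u v w : f (u + v) w = f u w + f v w.
  have uvE : (u + v) ^t* = u ^t* + v ^t*.
    by apply/matrixP => i j; rewrite !mxE rmorphD.
  by rewrite /f uvE !mulmxDl mxE.
have fDr u v w : f u (v + w) = f u v + f u w by rewrite /f mulmxDr mxE.
have pol u v : f v u = - f u v.
  have := f0 (u + v); rewrite fDl !fDr !f0 add0r addr0 addrC => /eqP.
  by rewrite addr_eq0 => /eqP.
have fZr u v : f u ('i *: v) = 'i * f u v by rewrite /f -scalemxAr mxE.
have fZl u v : f ('i *: v) u = - 'i * f v u.
  have ivE : ('i *: v) ^t* = - 'i *: v ^t*.
    by apply/matrixP => i j; rewrite !mxE rmorphM /= conjCi.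
  by rewrite /f ivE -!scalemxAl mxE.
have fuv0 u v : f u v = 0.
  have := pol u ('i *: v); rewrite fZr fZl pol mulrNN => /eqP.
  rewrite -subr_eq0 opprK -mulr2n mulrn_eq0 mulf_eq0 /=.
  by rewrite (negbTE (neq0Ci _)) => /eqP.
apply/matrixP => i j; have := fuv0 (delta_mx i 0) (delta_mx j 0).
by rewrite /f trmx_delta map_delta_mx -rowE -colE !mxE.
Qed.

(** The condition [psd] over an arbitrary closed field; at [R[i]] the two unfold to the same
    formula. *)
Definition positive n (M : 'M[C]_n) :=
  forall v : 'cV[C]_n, 0 <= (v ^t* *m M *m v) 0 0.

Lemma positive_hermitian n (M : 'M[C]_n) : positive M -> M ^t* = M.
Proof.
move=> M_pos; apply/eqP; rewrite -subr_eq0; apply/eqP.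
apply: form_eq0 => v; have := M_pos v; set W := _ *m v => W_ge0.
have -> : v ^t* *m (M ^t* - M) *m v = W ^t* - W.
  by rewrite /W mulmxBr mulmxBl !trmx_mul !map_mxM trmxCK mulmxA.
have /ger0_real/conj_Creal := W_ge0.
by move: {+}W => W' W'_real; rewrite !mxE W'_real subrr.
Qed.

(** Hermitian matrices are normal, so the spectral theorem diagonalises [M]; the eigenvalue [s 0 j]
    is the value of the form at the adjoint of row [j] of [P], hence nonnegative. *)
Lemma positive_spectral n (M : 'M[C]_n) : positive M ->
  exists2 P : 'M[C]_n, P \is unitarymx &
  exists2 s : 'rV[C]_n, (forall j, 0 <= s 0 j) & M = P ^t* *m diag_mx s *m P.
Proof.
move=> M_pos.
have /orthomx_spectralP : M \is normalmx.
  by apply/normalmxP; rewrite positive_hermitian.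
have := spectral_unitarymx M; move: (spectralmx M) (spectral_diag M) => P s PU.
rewrite invmx_unitary // => ME; exists P => //; exists s => // j.
have PPE : row j P *m P ^t* = delta_mx 0 j.
  by rewrite -row_mul (unitarymxP PU) row1.
have := M_pos ((row j P) ^t*); rewrite trmxCK ME !mulmxA PPE -mulmxA.
have -> : P *m (row j P) ^t* = delta_mx j 0.
  rewrite -[P]trmxCK -map_mxM -trmx_mul trmxCK PPE.
  by rewrite trmx_delta map_delta_mx.
by rewrite -rowE -colE !mxE eqxx mulr1n.
Qed.



(** Eigenvectors rescaled by square roots of eigenvalues. Applied to a Choi matrix, these vectors
    become Kraus operators. *)
Lemma positive_gram n (M : 'M[C]_n) : positive M ->
  exists v : 'I_n -> 'I_n -> C, forall i i', M i i' = \sum_j v j i * (v j i')^*.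
Proof.
move=> /positive_spectral[P _ [s s_ge0 ->]].
exists (fun j i => sqrtC (s 0 j) * (P j i)^*) => i i'.
rewrite !mxE; apply: eq_bigr => j _.
rewrite mul_mx_diag !mxE.
have sqrt_conj : (sqrtC (s 0 j))^* = sqrtC (s 0 j).
  by apply/conj_Creal/ger0_real; rewrite sqrtC_ge0.
rewrite [X in _ = _ * X]rmorphM /= sqrt_conj conjCK.
by rewrite mulrACA -expr2 sqrtCK; ring.
Qed.

Definition sqnorm m n (M : 'M[C]_(m, n)) := \sum_i \sum_j `|M i j| ^+ 2.

Lemma sqnorm_ge0 m n (M : 'M[C]_(m, n)) : 0 <= sqnorm M.
Proof. by do 2!apply: sumr_ge0 => ? _; apply: exprn_ge0. Qed.

Lemma sqnorm_trace m n (M : 'M[C]_(m, n)) : sqnorm M = \tr (M ^t* *m M).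
Proof.
rewrite /sqnorm exchange_big; apply: eq_bigr => j _.
by rewrite mxE; apply: eq_bigr => i _; rewrite !mxE normCK mulrC.
Qed.

(** AM-GM for the eigenvalues of [M ^t* *m M]: their product is the left side and their sum is
    [sqnorm M]. *)
Lemma det_le_sqnorm n (M : 'M[C]_n) : `|\det M| ^+ 2 <= (sqnorm M / n%:R) ^+ n.
Proof.
have /positive_spectral[P PU [s s_ge0 MME]] : positive (M ^t* *m M).
  move=> v; have -> : v ^t* *m (M ^t* *m M) *m v = (M *m v) ^t* *m (M *m v).
    by rewrite trmx_mul map_mxM !mulmxA.
  rewrite mxE; apply: sumr_ge0 => i _.
  by rewrite !mxE mulrC -normCK exprn_ge0.
have PPE : P *m P ^t* = 1%:M by exact/unitarymxP.
have -> : `|\det M| ^+ 2 = \prod_j s 0 j.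
  rewrite normCK mulrC -det_map_mx -[in LHS]det_tr map_trmx -det_mulmx.
  rewrite -[LHS]/(\det (M ^t* *m M)) MME -mulmxA det_mulmx mulrC -det_mulmx.
  by rewrite -mulmxA PPE mulmx1 det_diag.
have -> : sqnorm M = \sum_j s 0 j.
  rewrite sqnorm_trace MME mxtrace_mulC mulmxA PPE mul1mx.
  by rewrite mxtrace_diag.
have [] := @leif_AGM _ _ 'I_n (s 0); first by move=> j _; exact: s_ge0.
by rewrite card_ord.
Qed.

(* The determinants of a, c j and b multiply up to alpha j ^ n, which by AM-GM
   bounds the squared norms from below; the c j are proportional to each other,
   and testing contractivity on the conjugate of one of them sums over j. *)
Lemma scalar_sandwich_bound n (J : finType) (a b : 'M[C]_n) (c : J -> 'M[C]_n)
    (alpha : J -> C) :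
    (forall j, a *m c j *m b = (alpha j)%:M) ->
    (forall v : 'M[C]_n,
       \sum_j `|\sum_i \sum_k c j i k * v i k| ^+ 2 <= sqnorm v) ->
  (\sum_j `|alpha j| ^+ 2) * n%:R ^+ 3 <= sqnorm a * sqnorm b.
Proof.
move=> acb contr; have [n0|n_gt0] := posnP n.
  have -> : n%:R = 0 :> C by rewrite n0.
  by rewrite expr0n mulr0 mulr_ge0 ?sqnorm_ge0.
have [j0 aj0 | alpha0] := pickP (fun j => alpha j != 0); last first.
  rewrite big1 ?mul0r ?mulr_ge0 ?sqnorm_ge0 // => j _.
  by have /negbFE/eqP -> := alpha0 j; rewrite normr0 expr0n.
have n_pos : 0 < n%:R :> C by rewrite ltr0n.
have det0 : \det a * \det (c j0) * \det b = alpha j0 ^+ n.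
  by rewrite -!det_mulmx acb det_scalar.
have : \det a * \det (c j0) * \det b != 0 by rewrite det0 expf_neq0.
rewrite !mulf_eq0 !negb_or -!unitfE => /andP[/andP[a_unit _] b_unit].
(* Both sides agree once sandwiched between [a] and [b], which are invertible because the product of
   determinants is nonzero. *)
have prop j : alpha j0 *: c j = alpha j *: c j0.
  have : a *m (alpha j0 *: c j - alpha j *: c j0) *m b = 0.
    rewrite mulmxBr mulmxBl -!scalemxAr -!scalemxAl !acb !scale_scalar_mx.
    by rewrite mulrC subrr.
  move/(congr1 (mulmx^~ (invmx b))); rewrite mul0mx mulmxK ?unitmxE //.
  move/(congr1 (mulmx (invmx a))); rewrite mulmx0 mulKmx ?unitmxE //.
  by move/eqP; rewrite subr_eq0 => /eqP.
(* Compared after raising to the power [n], where the left side becomes a product of three squared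
   determinants. *)
have det_bound : `|alpha j0| ^+ 2 * n%:R ^+ 3 <= sqnorm a * sqnorm b * sqnorm (c j0).
  rewrite -ler_pdivlMr ?exprn_gt0 //.
  rewrite -(ler_pXn2r n_gt0) ?nnegrE ?exprn_ge0 ?divr_ge0 ?mulr_ge0 ?sqnorm_ge0 //.
  have -> : sqnorm a * sqnorm b * sqnorm (c j0) / n%:R ^+ 3 =
      sqnorm a / n%:R * (sqnorm (c j0) / n%:R) * (sqnorm b / n%:R).
    by field; rewrite gt_eqF.
  rewrite exprAC -normrX -det0 !normrM.
  have := det_le_sqnorm b; have := det_le_sqnorm (c j0); have := det_le_sqnorm a.
  have := normr_ge0 (\det (c j0)); have := normr_ge0 (\det a).
  have := normr_ge0 (\det b).
  move: `|\det a| `|\det b| `|\det (c j0)|.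
  move: (sqnorm a / _) (sqnorm (c j0) / _) (sqnorm b / _).
  move=> x' z' y' x y z y0 x0 z0 lex lez ley; rewrite !exprMn.
  by do ?apply: ler_pM; rewrite ?mulr_ge0 ?exprn_ge0.
have aj0_gt0 : 0 < `|alpha j0| ^+ 2 by rewrite exprn_gt0 ?normr_gt0.
have c_gt0 : 0 < sqnorm (c j0).
  rewrite lt_def sqnorm_ge0 andbT; apply: contraTneq det_bound => ->.
  by rewrite mulr0 lt_geF // mulr_gt0 // exprn_gt0.
(* Tested on the conjugate of [c j0], the inner sum for [j] equals
   [alpha j / alpha j0 * sqnorm (c j0)] by proportionality. *)
have c_small : (\sum_j `|alpha j| ^+ 2) * sqnorm (c j0) <= `|alpha j0| ^+ 2.
  rewrite -(ler_pM2r c_gt0) -mulrA -expr2 mulr_suml.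
  have sqnorm_conj : sqnorm (map_mx Num.conj (c j0)) = sqnorm (c j0).
    by do 2![apply: eq_bigr => ? _]; rewrite mxE norm_conjC.
  have := ler_wpM2l (ltW aj0_gt0) (contr (map_mx Num.conj (c j0))).
  rewrite sqnorm_conj; apply: le_trans; rewrite mulr_sumr.
  apply: ler_sum => j _; set w := \sum_i _.
  have wE : alpha j0 * w = alpha j * sqnorm (c j0).
    rewrite /w /sqnorm !mulr_sumr; apply: eq_bigr => i _.
    rewrite !mulr_sumr; apply: eq_bigr => k _; rewrite mxE normCK !mulrA.
    by have := congr1 (fun M : 'M_n => M i k) (prop j); rewrite !mxE => ->.
  by rewrite -[leRHS]exprMn -normrM wE normrM exprMn (ger0_norm (sqnorm_ge0 _)).
rewrite -(ler_pM2r aj0_gt0).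
apply: le_trans (ler_wpM2l (mulr_ge0 (sqnorm_ge0 a) (sqnorm_ge0 b)) c_small).
set s := \sum_j _.
have -> : sqnorm a * sqnorm b * (s * sqnorm (c j0)) =
    s * (sqnorm a * sqnorm b * sqnorm (c j0)) by ring.
have -> : s * n%:R ^+ 3 * `|alpha j0| ^+ 2 =
    s * (`|alpha j0| ^+ 2 * n%:R ^+ 3) by ring.
by apply: ler_wpM2l => //; apply: sumr_ge0 => j _; apply: exprn_ge0.
Qed.

End PositiveMatrices.

(** * Kraus forms of protocols *)

Section KrausOperators.
Local Open Scope sesquilinear_scope.
Variable C : numClosedFieldType.
Notation kraus Y X := 'M[C]_(#|{: Y}|, #|{: X}|).

Lemma sum_enum_rank (X : finType) (f : 'I_#|{: X}| -> C) :
  \sum_i f i = \sum_x f (enum_rank x).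
Proof. by rewrite (reindex _ (onW_bij _ (@enum_rank_bij X))). Qed.

Lemma sum_triple (X Y Z : finType) (f : X * Y * Z -> C) :
  \sum_t f t = \sum_x \sum_y \sum_z f (x, y, z).
Proof.
rewrite pair_bigA /= pair_bigA /=; apply: eq_bigr => t _.
by case: t => -[].
Qed.

Lemma matrix_rankP (X Y : finType) (M N : kraus Y X) :
  (forall y x, M (enum_rank y) (enum_rank x) = N (enum_rank y) (enum_rank x)) ->
  M = N.
Proof.
move=> MN; apply/matrixP => i j.
by have := MN (enum_val i) (enum_val j); rewrite !enum_valK.
Qed.

(** The Kronecker product of three operators, indexed by the enumeration of the product basis. *)
Definition kprod (X Y Z X' Y' Z' : finType)
    (a : kraus X' X) (b : kraus Y' Y) (c : kraus Z' Z) :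
    kraus (X' * Y' * Z')%type (X * Y * Z)%type :=
  \matrix_(i, j) (a (enum_rank (enum_val i).1.1) (enum_rank (enum_val j).1.1)
    * b (enum_rank (enum_val i).1.2) (enum_rank (enum_val j).1.2)
    * c (enum_rank (enum_val i).2) (enum_rank (enum_val j).2)).

Lemma kprodE (X Y Z X' Y' Z' : finType)
    (a : kraus X' X) (b : kraus Y' Y) (c : kraus Z' Z) x y z x' y' z' :
  kprod a b c (enum_rank (x', y', z')) (enum_rank (x, y, z)) =
  a (enum_rank x') (enum_rank x) * b (enum_rank y') (enum_rank y)
    * c (enum_rank z') (enum_rank z).
Proof. by rewrite mxE !enum_rankK. Qed.

Lemma kprod1 (X Y Z : finType) :
  kprod 1%:M 1%:M 1%:M = 1%:M :> kraus (X * Y * Z)%type (X * Y * Z)%type.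
Proof.
apply: matrix_rankP => -[[x' y'] z'] [[x y] z]; rewrite kprodE !mxE.
by rewrite !(inj_eq enum_rank_inj) !xpair_eqE -!natrM !mulnb.
Qed.

Lemma mul_kprod (X Y Z X' Y' Z' X2 Y2 Z2 : finType)
    (a : kraus X' X) (b : kraus Y' Y) (c : kraus Z' Z)
    (a2 : kraus X2 X') (b2 : kraus Y2 Y') (c2 : kraus Z2 Z') :
  kprod a2 b2 c2 *m kprod a b c = kprod (a2 *m a) (b2 *m b) (c2 *m c).
Proof.
apply: matrix_rankP => -[[x2 y2] z2] [[x y] z]; rewrite kprodE !mxE.
rewrite !sum_enum_rank sum_triple mulr_suml mulr_suml; apply: eq_bigr => x' _.
rewrite [X in _ = X * _]mulr_sumr mulr_suml; apply: eq_bigr => y' _.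
rewrite mulr_sumr; apply: eq_bigr => z' _.
by rewrite !kprodE; ring.
Qed.

Lemma mul_sandwich m n p (K : 'M[C]_(p, n)) (N : 'M[C]_(n, m)) (rho : 'M[C]_m) :
  K *m (N *m rho *m N ^t*) *m K ^t* = (K *m N) *m rho *m (K *m N) ^t*.
Proof. by rewrite trmx_mul map_mxM !mulmxA. Qed.

Lemma sandwichE (X Y : finType) (K : kraus Y X) (rho : 'M[C]_#|{: X}|) i j :
  (K *m rho *m K ^t*) i j =
  \sum_x K i (enum_rank x) *
    \sum_x' (K j (enum_rank x'))^* * rho (enum_rank x) (enum_rank x').
Proof.
rewrite -mulmxA mxE sum_enum_rank; apply: eq_bigr => x _; congr (_ * _).
by rewrite mxE sum_enum_rank; apply: eq_bigr => x' _; rewrite !mxE mulrC.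
Qed.

Lemma mul_sandwich_ket m n (K : 'M[C]_(n, m)) (u : 'cV[C]_m) :
  (K *m u) *m (K *m u) ^t* = K *m (u *m u ^t*) *m K ^t*.
Proof. by rewrite trmx_mul map_mxM !mulmxA. Qed.

(** The identity factors collapse the sum over triples. An arbitrary [f] lets the rule serve twice
    in a sandwich, for [K] and for its conjugate. *)
Lemma sum_kprod_A (X Y Z X' : finType) (K : kraus X' X) x' y z
    (f : X * Y * Z -> C) :
  \sum_t kprod K 1%:M 1%:M (enum_rank (x', y, z)) (enum_rank t) * f t =
  \sum_x K (enum_rank x') (enum_rank x) * f (x, y, z).
Proof.
rewrite sum_triple; apply: eq_bigr => x _.
rewrite (bigD1 y) //= (bigD1 z) //= big1 ?addr0 => [|z' /negbTE z'z].
  rewrite big1 ?addr0 => [|y' /negbTE y'y]; last first.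
    rewrite big1 // => z' _.
    by rewrite kprodE !mxE (inj_eq enum_rank_inj) eq_sym y'y mulr0 !mul0r.
  by rewrite kprodE !mxE !eqxx !mulr1.
by rewrite kprodE !mxE !(inj_eq enum_rank_inj) (eq_sym z) z'z mulr0 mul0r.
Qed.

Lemma sum_kprod_B (X Y Z Y' : finType) (K : kraus Y' Y) x y' z
    (f : X * Y * Z -> C) :
  \sum_t kprod 1%:M K 1%:M (enum_rank (x, y', z)) (enum_rank t) * f t =
  \sum_y K (enum_rank y') (enum_rank y) * f (x, y, z).
Proof.
rewrite sum_triple (bigD1 x) //= [X in _ + X]big1 ?addr0; last first.
  move=> x' /negbTE x'x; do 2![rewrite big1 // => ? _].
  by rewrite kprodE !mxE (inj_eq enum_rank_inj) eq_sym x'x !mul0r.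
apply: eq_bigr => y _; rewrite (bigD1 z) //= big1 ?addr0 => [|z' /negbTE z'z].
  by rewrite kprodE !mxE !eqxx mul1r mulr1.
by rewrite kprodE !mxE !(inj_eq enum_rank_inj) (eq_sym z) z'z mulr0 mul0r.
Qed.

Lemma sum_kprod_C (X Y Z Z' : finType) (K : kraus Z' Z) x y z'
    (f : X * Y * Z -> C) :
  \sum_t kprod 1%:M 1%:M K (enum_rank (x, y, z')) (enum_rank t) * f t =
  \sum_z K (enum_rank z') (enum_rank z) * f (x, y, z).
Proof.
rewrite sum_triple (bigD1 x) //= [X in _ + X]big1 ?addr0; last first.
  move=> x' /negbTE x'x; do 2![rewrite big1 // => ? _].
  by rewrite kprodE !mxE (inj_eq enum_rank_inj) eq_sym x'x !mul0r.
rewrite (bigD1 y) //= [X in _ + X]big1 ?addr0; last first.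
  move=> y' /negbTE y'y; rewrite big1 // => z _.
  by rewrite kprodE !mxE !(inj_eq enum_rank_inj) (eq_sym y) y'y mulr0 !mul0r.
by apply: eq_bigr => z _; rewrite kprodE !mxE !eqxx !mul1r.
Qed.

Lemma kprod_conj (X Y Z X' Y' Z' : finType)
    (a : kraus X' X) (b : kraus Y' Y) (c : kraus Z' Z) i j :
  (kprod a b c i j)^* =
  kprod (map_mx Num.conj a) (map_mx Num.conj b) (map_mx Num.conj c) i j.
Proof. by rewrite !mxE !rmorphM. Qed.

End KrausOperators.

(** * Kraus decompositions of instruments and of whole protocols *)

Section ProtocolKraus.
Local Open Scope sesquilinear_scope.
Variable R : realType.
Notation kraus Y X := 'M[R[i]]_(#|{: Y}|, #|{: X}|).

Lemma entry_mkop (X : finType) (f : X -> X -> R[i]) x x' :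
  entry (mkop f) x x' = f x x'.
Proof. by rewrite /entry mxE !enum_rankK. Qed.

Lemma op_ext (X : finType) (rho sigma : op R X) :
  (forall x x', entry rho x x' = entry sigma x x') -> rho = sigma.
Proof. exact: matrix_rankP. Qed.

Lemma on_A_kraus (A B C A' : finType) (Phi : op R A -> op R A') (J : finType)
    (K : J -> kraus A' A) :
  (forall rho, Phi rho = \sum_j K j *m rho *m (K j) ^t*) ->
  forall rho : op R (A * B * C)%type, on_A Phi rho =
    \sum_j kprod (K j) 1%:M 1%:M *m rho *m (kprod (K j) 1%:M 1%:M) ^t*.
Proof.
move=> PhiE rho; apply: op_ext => -[[a b] c] [[a' b'] c'].
rewrite entry_mkop PhiE /entry !summxE; apply: eq_bigr => j _.
rewrite !sandwichE sum_kprod_A; apply: eq_bigr => x _; congr (_ * _).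
under [RHS]eq_bigr do rewrite kprod_conj !map_mx1.
rewrite sum_kprod_A; apply: eq_bigr => x' _.
by rewrite !mxE !enum_rankK.
Qed.

Lemma on_B_kraus (A B C B' : finType) (Phi : op R B -> op R B') (J : finType)
    (K : J -> kraus B' B) :
  (forall rho, Phi rho = \sum_j K j *m rho *m (K j) ^t*) ->
  forall rho : op R (A * B * C)%type, on_B Phi rho =
    \sum_j kprod 1%:M (K j) 1%:M *m rho *m (kprod 1%:M (K j) 1%:M) ^t*.
Proof.
move=> PhiE rho; apply: op_ext => -[[a b] c] [[a' b'] c'].
rewrite entry_mkop PhiE /entry !summxE; apply: eq_bigr => j _.
rewrite !sandwichE sum_kprod_B; apply: eq_bigr => x _; congr (_ * _).
under [RHS]eq_bigr do rewrite kprod_conj !map_mx1.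
rewrite sum_kprod_B; apply: eq_bigr => x' _.
by rewrite !mxE !enum_rankK.
Qed.

Lemma on_C_kraus (A B C C' : finType) (Phi : op R C -> op R C') (J : finType)
    (K : J -> kraus C' C) :
  (forall rho, Phi rho = \sum_j K j *m rho *m (K j) ^t*) ->
  forall rho : op R (A * B * C)%type, on_C Phi rho =
    \sum_j kprod 1%:M 1%:M (K j) *m rho *m (kprod 1%:M 1%:M (K j)) ^t*.
Proof.
move=> PhiE rho; apply: op_ext => -[[a b] c] [[a' b'] c'].
rewrite entry_mkop PhiE /entry !summxE; apply: eq_bigr => j _.
rewrite !sandwichE sum_kprod_C; apply: eq_bigr => x _; congr (_ * _).
under [RHS]eq_bigr do rewrite kprod_conj !map_mx1.
rewrite sum_kprod_C; apply: eq_bigr => x' _.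
by rewrite !mxE !enum_rankK.
Qed.


(** Choi's theorem: complete positivity with an ancilla of the dimension of [X], applied to the
    unnormalised maximally entangled ket [w], makes the Choi matrix positive; its Gram vectors,
    reshaped, are the Kraus operators. *)
Lemma cp_kraus (X Y : finType) (Phi : {linear op R X -> op R Y}) :
  completely_positive Phi ->
  exists J : finType, exists K : J -> kraus Y X,
    forall rho, Phi rho = \sum_j K j *m rho *m (K j) ^t*.
Proof.
move=> Phi_cp; pose k := #|{: X}|.
pose w : 'cV[R[i]]_#|{: X * 'I_k}| :=
  \col_p (enum_rank (enum_val p).1 == (enum_val p).2)%:R.
have w_psd : psd (w *m w ^t*).
  move=> v; have -> : v ^t* *m (w *m w ^t*) *m v = (v ^t* *m w) *m (v ^t* *m w) ^t*.
    by rewrite trmx_mul map_mxM trmxCK !mulmxA.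
  by rewrite mxE big_ord1 !mxE -normCK exprn_ge0.
have /positive_gram[v vE] := Phi_cp k (w *m w ^t*) w_psd.
exists 'I_#|{: Y * 'I_k}|.
exists (fun l => \matrix_(p, i) v l (enum_rank (enum_val p, i))) => rho.
apply: matrix_rankP => y y'; rewrite summxE.
(* The block [(i, i')] of the Choi matrix is the image of a matrix unit; linearity then recovers
   [Phi]. *)
have deltaE i i' y1 y2 : Phi (delta_mx i i') (enum_rank y1) (enum_rank y2) =
    \sum_l v l (enum_rank (y1, i)) * (v l (enum_rank (y2, i')))^*.
  rewrite -vE /ampliate mxE !enum_rankK /=; congr (Phi _ _ _).
  apply: matrix_rankP => x x'.
  rewrite [RHS]mxE !enum_rankK /entry [in RHS]mxE big_ord1 !mxE !enum_rankK /=.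
  by rewrite conjC_nat -natrM mulnb.
rewrite [in LHS](matrix_sum_delta rho) linear_sum summxE.
under eq_bigr do rewrite linear_sum summxE.
under [RHS]eq_bigr do rewrite mxE.
rewrite [LHS]exchange_big [RHS]exchange_big /=; apply: eq_bigr => i' _.
under [RHS]eq_bigr do rewrite mxE mulr_suml.
rewrite [RHS]exchange_big /=; apply: eq_bigr => i _.
rewrite linearZ mxE deltaE mulr_sumr; apply: eq_bigr => l _.
by rewrite !mxE !enum_rankK; ring.
Qed.

(** Trace preservation, read on the rank-one operator of [u], becomes conservation of the total
    squared norm. *)
Lemma instrument_kraus (X M : finType) (Y : M -> finType)
    (E : forall m, {linear op R X -> op R (Y m)}) :
  instrument E ->
  exists (J : M -> finType) (K : forall m, J m -> kraus (Y m) X),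
    (forall m rho, E m rho = \sum_j K m j *m rho *m (K m j) ^t*) /\
    (forall u : 'cV_#|{: X}|, \sum_m \sum_j sqnorm (K m j *m u) = sqnorm u).
Proof.
move=> [E_cp E_tr]; pose KJ m := cid (cp_kraus (E_cp m)).
exists (fun m => sval (KJ m)), (fun m => sval (cid (svalP (KJ m)))).
have KE m rho : E m rho = \sum_j sval (cid (svalP (KJ m))) j *m rho *m
    (sval (cid (svalP (KJ m))) j) ^t* by exact: (svalP (cid (svalP (KJ m)))).
split=> // u; rewrite [RHS]sqnorm_trace mxtrace_mulC -E_tr.
apply: eq_bigr => m _; rewrite KE raddf_sum; apply: eq_bigr => j _ /=.
by rewrite -mul_sandwich_ket sqnorm_trace mxtrace_mulC.
Qed.

(* A branch fixes the announced transcript and the Kraus operators of Alice and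
   Bob; the remaining index [hidden], private to Charlie, runs over the Kraus
   operators of his accumulated operation. *)
Record kraus_form (A B C A' B' C' : finType) := KrausForm {
  branch : finType;
  hidden : branch -> finType;
  krausA : branch -> kraus A' A;
  krausB : branch -> kraus B' B;
  krausC : forall t, hidden t -> kraus C' C }.

Definition kraus3 (A B C A' B' C' : finType) (Q : kraus_form A B C A' B' C')
    (t : branch Q) (j : hidden t) :=
  kprod (krausA t) (krausB t) (krausC j).

Definition represents (A B C A' B' C' : finType)
    (Q : kraus_form A B C A' B' C') (L : map3 R A B C A' B' C') :=
  forall rho, L rho =
    \sum_(t : branch Q) \sum_(j : hidden t) kraus3 j *m rho *m (kraus3 j) ^t*.

(** Only an inequality, since a branch contains just those of Charlie's operators that belong to one
    transcript. *)
Definition contractive_C (A B C A' B' C' : finType)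
    (Q : kraus_form A B C A' B' C') :=
  forall (t : branch Q) (v : 'cV_#|{: C}|),
    \sum_(j : hidden t) sqnorm (krausC j *m v) <= sqnorm v.

(* The weight of a branch ignores Charlie's operators, so that the total weight
   counts every one of his messages with probability 1. *)
Definition weight_AB_le (A B C A' B' C' : finType)
    (Q : kraus_form A B C A' B' C') (w : R[i]) :=
  forall (u : 'cV_#|{: A}|) (v : 'cV_#|{: B}|),
    \sum_(t : branch Q) sqnorm (krausA t *m u) * sqnorm (krausB t *m v) <=
    w * (sqnorm u * sqnorm v).

Lemma sum_tagged (V : nmodType) (M : finType) (S : M -> finType)
    (F : {m & S m} -> V) :
  \sum_x F x = \sum_m \sum_s F (existT _ m s).
Proof. by rewrite sig_big_dep; apply: eq_bigr => -[]. Qed.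

Lemma sum_pair (V : nmodType) (S T : finType) (F : S * T -> V) :
  \sum_x F x = \sum_s \sum_t F (s, t).
Proof. by rewrite pair_bigA; apply: eq_bigr => -[]. Qed.

Lemma sum_unit (V : nmodType) (F : unit -> V) : \sum_x F x = F tt.
Proof. by rewrite (bigD1 tt) //= big1 ?addr0 // => -[]. Qed.

Lemma pow2_le_max (M : finType) (k : M -> nat) m :
  2 ^+ k m <= 2 ^+ (\max_m k m) :> R[i].
Proof. by rewrite ler_weXn2l ?ler1n // leq_bigmax. Qed.

(** Induction on the tree. At a node of Alice or Bob, the outcome and the Kraus index both enter the
    branch. At a node of Charlie, only the announced string does, and his Kraus index joins
    [hidden]. *)
Lemma protocol_kraus_form (A B C A' B' C' : finType)
    (p : protocol R A' B' C' A B C) :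
  exists Q : kraus_form A B C A' B' C',
    [/\ represents Q (run p), contractive_C Q
      & weight_AB_le Q (2 ^+ bits_from_C p)].
Proof.
elim: p => {A B C} [|A B C M Y E E_instr next IH|A B C M Y E E_instr next IH
  |A B C k Y E E_instr next IH] /=.
- exists (KrausForm (fun _ : unit => 1%:M) (fun=> 1%:M)
    (fun _ (_ : unit) => 1%:M)).
  split.
  + move=> rho; rewrite !sum_unit /kraus3 /= kprod1.
    by rewrite mul1mx trmx1 map_mx1 mulmx1.
  + by move=> t v; rewrite sum_unit mul1mx.
  + by move=> u v; rewrite sum_unit !mul1mx mul1r.
- have [J [K [KE K_tr]]] := instrument_kraus E_instr.
  pose Q m := sval (cid (IH m)).
  have Q_spec m : [/\ represents (Q m) (run (next m)), contractive_C (Q m)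
      & weight_AB_le (Q m) (2 ^+ bits_from_C (next m))] := svalP (cid (IH m)).
  exists (@KrausForm _ _ _ _ _ _ {m & (J m * branch (Q m))%type}
    (fun x => hidden (tagged x).2)
    (fun x => krausA (tagged x).2 *m K (tag x) (tagged x).1)
    (fun x => krausB (tagged x).2)
    (fun x j => krausC j)).
  split.
  + move=> rho; rewrite sum_tagged; apply: eq_bigr => m _.
    have [-> _ _] := Q_spec m; rewrite sum_pair /= [RHS]exchange_big.
    apply: eq_bigr => t _; rewrite [RHS]exchange_big; apply: eq_bigr => j _ /=.
    rewrite (on_A_kraus (KE m)) mulmx_sumr mulmx_suml; apply: eq_bigr => l _.
    by rewrite mul_sandwich mul_kprod !mulmx1.
  + by move=> [m [l t]] v; have [_ + _] := Q_spec m; apply.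
  (* Norm conservation splits the squared norm of [u] over the images [K m l *m u], to which the
     induction hypothesis applies: Alice's outcomes cost no factor. *)
  + move=> u v; rewrite sum_tagged -(K_tr u) mulr_suml mulr_sumr.
    apply: ler_sum => m _; rewrite sum_pair /= mulr_suml mulr_sumr.
    apply: ler_sum => l _; have [_ _ weight_m] := Q_spec m.
    apply: le_trans (le_trans (weight_m (K m l *m u) v) _).
      by apply: ler_sum => t _; rewrite mulmxA.
    apply: ler_wpM2r; first by rewrite mulr_ge0 ?sqnorm_ge0.
    exact: (pow2_le_max (fun m => bits_from_C (next m))).
- have [J [K [KE K_tr]]] := instrument_kraus E_instr.
  pose Q m := sval (cid (IH m)).
  have Q_spec m : [/\ represents (Q m) (run (next m)), contractive_C (Q m)
      & weight_AB_le (Q m) (2 ^+ bits_from_C (next m))] := svalP (cid (IH m)).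
  exists (@KrausForm _ _ _ _ _ _ {m & (J m * branch (Q m))%type}
    (fun x => hidden (tagged x).2)
    (fun x => krausA (tagged x).2)
    (fun x => krausB (tagged x).2 *m K (tag x) (tagged x).1)
    (fun x j => krausC j)).
  split.
  + move=> rho; rewrite sum_tagged; apply: eq_bigr => m _.
    have [-> _ _] := Q_spec m; rewrite sum_pair /= [RHS]exchange_big.
    apply: eq_bigr => t _; rewrite [RHS]exchange_big; apply: eq_bigr => j _ /=.
    rewrite (on_B_kraus (KE m)) mulmx_sumr mulmx_suml; apply: eq_bigr => l _.
    by rewrite mul_sandwich mul_kprod !mulmx1.
  + by move=> [m [l t]] v; have [_ + _] := Q_spec m; apply.
  + move=> u v; rewrite sum_tagged -(K_tr v) [X in _ <= _ * X]mulr_sumr mulr_sumr.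
    apply: ler_sum => m _; rewrite sum_pair /= [X in _ <= _ * X]mulr_sumr mulr_sumr.
    apply: ler_sum => l _; have [_ _ weight_m] := Q_spec m.
    apply: le_trans (le_trans (weight_m u (K m l *m v)) _).
      by apply: ler_sum => t _; rewrite mulmxA.
    apply: ler_wpM2r; first by rewrite mulr_ge0 ?sqnorm_ge0.
    exact: (pow2_le_max (fun m => bits_from_C (next m))).
- have [J [K [KE K_tr]]] := instrument_kraus E_instr.
  pose Q m := sval (cid (IH m)).
  have Q_spec m : [/\ represents (Q m) (run (next m)), contractive_C (Q m)
      & weight_AB_le (Q m) (2 ^+ bits_from_C (next m))] := svalP (cid (IH m)).
  exists (@KrausForm _ _ _ _ _ _ {m & branch (Q m)}
    (fun x => (J (tag x) * hidden (tagged x))%type : finType)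
    (fun x => krausA (tagged x)) (fun x => krausB (tagged x))
    (fun x lj => krausC lj.2 *m K (tag x) lj.1)).
  split.
  + move=> rho; rewrite sum_tagged; apply: eq_bigr => m _.
    have [-> _ _] := Q_spec m; apply: eq_bigr => t _.
    rewrite sum_pair [RHS]exchange_big; apply: eq_bigr => j _ /=.
    rewrite (on_C_kraus (KE m)) mulmx_sumr mulmx_suml; apply: eq_bigr => l _.
    by rewrite mul_sandwich mul_kprod !mulmx1.
  (* The branch fixes the message [m]; the share of the other messages in the norm of [v] is
     discarded. *)
  + move=> [m t] v; rewrite sum_pair -(K_tr v) (bigD1 m) //=.
    rewrite -[leLHS]addr0; apply: lerD; last first.
      by do 2!apply: sumr_ge0 => ? _; apply: sqnorm_ge0.
    apply: ler_sum => l _; have [_ contr_m _] := Q_spec m.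
    apply: le_trans (contr_m t (K m l *m v)).
    by apply: ler_sum => j _; rewrite mulmxA.
  + move=> u v; rewrite sum_tagged exprD -mulrA.
    (* Each of the [2 ^ k] messages is counted with weight 1, since Charlie's operators are ignored
       here. *)
    have -> : 2 ^+ k = \sum_(m : k.-tuple bool) 1 :> R[i].
      by rewrite sumr_const card_tuple card_bool natrX.
    rewrite mulr_suml; apply: ler_sum => m _; rewrite mul1r.
    have [_ _ /(_ u v)] := Q_spec m.
    move/le_trans; apply; apply: ler_wpM2r; first by rewrite mulr_ge0 ?sqnorm_ge0.
    exact: (pow2_le_max (fun m => bits_from_C (next m))).
Qed.

End ProtocolKraus.

(** * Probability of one branch *)

Section BranchBounds.
Local Open Scope sesquilinear_scope.
Variable C : numClosedFieldType.

Lemma cauchy_schwarz n (x y : 'I_n -> C) :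
  `|\sum_i x i * y i| ^+ 2 <= (\sum_i `|x i| ^+ 2) * (\sum_i `|y i| ^+ 2).
Proof.
pose u : 'rV_n := \row_i x i; pose v : 'rV_n := \row_i (y i)^*.
have CS : `|dotmx u v| ^+ 2 <= dotmx u u * dotmx v v.
  by have [] := CauchySchwarz (@dotmx C n) u v.
move: CS; rewrite !dotmxE !mxE.
congr (`|_| ^+ 2 <= _ * _); apply: eq_bigr => i _; rewrite !mxE ?conjCK ?normCK //.
by rewrite mulrC.
Qed.

(** Pure states are extremal. The scalar [alpha k] is read off at a coordinate where [f] is nonzero;
    expanding the squared residuals and substituting the hypothesis gives total 0, so each of them
    vanishes. *)
Lemma rank_one_decomposition n (K : finType) (v : K -> 'cV[C]_n) (f : 'cV[C]_n) :
  \sum_k v k *m (v k) ^t* = f *m f ^t* -> f != 0 ->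
  exists2 alpha : K -> C, forall k, v k = alpha k *: f
    & \sum_k `|alpha k| ^+ 2 = 1.
Proof.
move=> vf /matrix0Pn[p0 [z]]; rewrite {z}ord1 => f0.
have vfE p q : \sum_k v k p 0 * (v k q 0)^* = f p 0 * (f q 0)^*.
  have := congr1 (fun M : 'M_n => M p q) vf; rewrite summxE !mxE big_ord1 !mxE.
  by move=> <-; apply: eq_bigr => k _; rewrite !mxE big_ord1 !mxE.
pose alpha k := v k p0 0 / f p0 0; exists alpha; last first.
  under eq_bigr do rewrite normf_div expr_div_n !normCK.
  by rewrite -mulr_suml vfE divff // mulf_neq0 ?conjC_eq0.
have res0 p : \sum_k `|v k p 0 - alpha k * f p 0| ^+ 2 = 0.
  transitivity (\sum_k v k p 0 * (v k p 0)^*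
    - (f p 0 / f p0 0)^* * \sum_k v k p 0 * (v k p0 0)^*
    - f p 0 / f p0 0 * \sum_k v k p0 0 * (v k p 0)^*
    + f p 0 / f p0 0 * (f p 0 / f p0 0)^* * \sum_k v k p0 0 * (v k p0 0)^*).
    rewrite !mulr_sumr -!sumrB -big_split; apply: eq_bigr => k _ /=.
    rewrite normCK /alpha rmorphB !rmorphM fmorphV; ring.
  rewrite !vfE rmorphM fmorphV; field.
  by rewrite f0 andbT conjC_eq0.
move=> k; apply/colP => p; rewrite mxE.
have /eqP := res0 p; rewrite psumr_eq0 => [|? _]; last exact: exprn_ge0.
move/allP/(_ k (mem_index_enum k)); rewrite /= expf_eq0 /= normr_eq0 subr_eq0.
by move/eqP.
Qed.

(* Contractivity is tested on h i = <conj b_i, a_i>, because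
   sum_i c j i * h i = tr (a *m diag (c j) *m b^T) = n * alpha j. *)
Lemma ghz_epr_branch n (J : finType) (a b : 'M[C]_n) (c : J -> 'I_n -> C)
    (alpha : J -> C) :
    (forall j x y, \sum_i a x i * b y i * c j i = alpha j * (x == y)%:R) ->
    (forall v : 'I_n -> C,
       \sum_j `|\sum_i c j i * v i| ^+ 2 <= \sum_i `|v i| ^+ 2) ->
  (\sum_j `|alpha j| ^+ 2) * n%:R ^+ 2 <=
    \sum_i (\sum_x `|a x i| ^+ 2) * (\sum_y `|b y i| ^+ 2).
Proof.
move=> abc contr; pose h i := \sum_x a x i * b x i.
apply: (@le_trans _ _ (\sum_i `|h i| ^+ 2)); last first.
  by apply: ler_sum => i _; apply: cauchy_schwarz.
apply: le_trans (contr h); rewrite mulr_suml; apply: ler_sum => j _.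
have -> : \sum_i c j i * h i = alpha j * n%:R.
  rewrite -[in RHS](card_ord n) -sumr_const mulr_sumr /h.
  under eq_bigr do rewrite mulr_sumr.
  rewrite exchange_big; apply: eq_bigr => x _; have := abc j x x.
  by rewrite eqxx => <-; apply: eq_bigr => i _; rewrite mulrC.
by rewrite normrM exprMn (ger0_norm (ler0n _ _)).
Qed.

(* Contractivity of the l-th row of Charlie is tested on the product of the l-th
   rows of a and b. *)
Lemma two_epr_ghz_branch n (J : finType) (a b : 'M[C]_n)
    (c : J -> 'I_n -> 'I_n -> 'I_n -> C) (alpha : J -> C) :
    (forall j l, \sum_i \sum_k a l i * b l k * c j l i k = alpha j) ->
    (forall l (v : 'M_n),
       \sum_j `|\sum_i \sum_k c j l i k * v i k| ^+ 2 <= sqnorm v) ->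
  (\sum_j `|alpha j| ^+ 2) * n%:R ^+ 2 <= sqnorm a * sqnorm b.
Proof.
move=> abc contr; set s := \sum_j _.
pose f l := \sum_i `|a l i| ^+ 2; pose g l := \sum_i `|b l i| ^+ 2.
have f_ge0 l : 0 <= f l by apply: sumr_ge0 => ? _; apply: exprn_ge0.
have g_ge0 l : 0 <= g l by apply: sumr_ge0 => ? _; apply: exprn_ge0.
have s_ge0 : 0 <= s by apply: sumr_ge0 => ? _; apply: exprn_ge0.
have sfg l : s <= f l * g l.
  have := contr l (\matrix_(i, k) (a l i * b l k)); congr (_ <= _).
    apply: eq_bigr => j _; rewrite -(abc j l); congr (`|_| ^+ 2).
    by do 2![apply: eq_bigr => ? _]; rewrite mxE mulrC.
  rewrite mulr_suml; apply: eq_bigr => i _; rewrite mulr_sumr.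
  by apply: eq_bigr => k _; rewrite mxE normrM exprMn.
(* AM-GM on the two summands, whose product regroups as [(f l * g l) * (f l' * g l')], at least
   [s ^+ 2]. Summing over all pairs then yields twice the product of the norms. *)
have cross l l' : s *+ 2 <= f l * g l' + f l' * g l.
  rewrite -(ler_pXn2r (ltn0Sn 1)) ?nnegrE ?addr_ge0 ?mulr_ge0 ?mulrn_wge0 //.
  have [+ _] := real_leif_AGM2_scaled
    (ger0_real (mulr_ge0 (f_ge0 l) (g_ge0 l')))
    (ger0_real (mulr_ge0 (f_ge0 l') (g_ge0 l))).
  apply: le_trans; rewrite exprMn_n ler_wMn2r //.
  have -> : f l * g l' * (f l' * g l) = f l * g l * (f l' * g l') by ring.
  by rewrite expr2 ler_pM.
have -> : sqnorm a = \sum_l f l by [].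
have -> : sqnorm b = \sum_l g l by [].
rewrite -(ler_pMn2r (ltn0Sn 1)).
have -> : (\sum_l f l) * (\sum_l g l) *+ 2 =
    \sum_l \sum_l' (f l * g l' + f l' * g l).
  rewrite mulr2n; under [RHS]eq_bigr do rewrite big_split.
  rewrite big_split [X in _ = _ + X]exchange_big /= mulr_suml.
  by congr (_ + _); apply: eq_bigr => l _; rewrite mulr_sumr.
have -> : s * n%:R ^+ 2 *+ 2 = \sum_(l < n) \sum_(l' < n) s *+ 2.
  rewrite !sumr_const !card_ord -natrX mulr_natr -!mulrnA; congr (_ *+ _).
  by rewrite -mulnn mulnC mulnA.
by do 2!apply: ler_sum => ? _.
Qed.

End BranchBounds.

(** * Many copies *)

Section TensorPowers.
Local Open Scope sesquilinear_scope.
Variable R : realType.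
Notation kraus Y X := 'M[R[i]]_(#|{: Y}|, #|{: X}|).
Variables A B C A' B' C' : finType.
Implicit Types L : map3 R A B C A' B' C'.

Lemma represents_linear (Q : kraus_form R A B C A' B' C') L :
  represents Q L -> linear L.
Proof.
move=> QL z rho sigma; rewrite !QL scaler_sumr -big_split; apply: eq_bigr => t _.
rewrite scaler_sumr -big_split; apply: eq_bigr => j _ /=.
by rewrite mulmxDr mulmxDl -scalemxAr -scalemxAl.
Qed.

Lemma locc_linear L : locc L -> linear L.
Proof.
move=> [p pL]; have [Q [Qp _ _]] := protocol_kraus_form p.
by apply: (@represents_linear Q) => rho; rewrite -pL Qp.
Qed.

Lemma AB_output_linear L : linear L -> linear (AB_output L).
Proof.
move=> L_lin z rho sigma; apply: op_ext => -[[a b] []] [[a' b'] []].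
rewrite /AB_output L_lin /entry mxE !mxE !enum_rankK mulr_sumr -big_split.
by apply: eq_bigr => c _; rewrite /entry !mxE.
Qed.

Lemma linear_entry L rho y y' : linear L ->
  entry (L rho) y y' =
  \sum_x \sum_x' entry rho x x' * entry (L (unit_op R x x')) y y'.
Proof.
move=> L_lin; pose L' : {linear op R (A * B * C)%type -> op R (A' * B' * C')%type} :=
  HB.pack L (GRing.isLinear.Build _ _ _ _ L L_lin).
rewrite -[L]/(L' : _ -> _) [in LHS](matrix_sum_delta rho) linear_sum /entry summxE.
rewrite (sum_enum_rank (C := R[i])); apply: eq_bigr => x _.
rewrite linear_sum summxE (sum_enum_rank (C := R[i])); apply: eq_bigr => x' _.
by rewrite linearZ mxE.
Qed.

Definition ket_power (X Y Z : finType) n (psi : X * Y * Z -> R[i]) :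
    copies n X * copies n Y * copies n Z -> R[i] :=
  fun x => \prod_k psi (nth_copy x k).

Lemma entry_proj (X : finType) (psi : X -> R[i]) x x' :
  entry (proj (mkket psi)) x x' = psi x * (psi x')^*.
Proof. by rewrite /entry mxE big_ord1 !mxE !enum_rankK. Qed.

(** Distributivity, after regrouping a family of triples into a triple of families, one per
    party. *)
Lemma sum_prod_copies (X Y Z : finType) n (g : 'I_n -> X * Y * Z -> R[i]) :
  \sum_(x : copies n X * copies n Y * copies n Z) \prod_k g k (nth_copy x k) =
  \prod_k \sum_x g k x.
Proof.
rewrite bigA_distr_bigA /=.
pose f (h : copies n (X * Y * Z)) : copies n X * copies n Y * copies n Z :=
  ([ffun k => (h k).1.1], [ffun k => (h k).1.2], [ffun k => (h k).2]).
have f_bij : bijective f.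
  exists (fun x => [ffun k => nth_copy x k]).
    move=> h; apply/ffunP => k; rewrite !ffunE /nth_copy /= !ffunE.
    by case: (h k) => -[].
  by move=> [[x y] z]; congr (_, _, _); apply/ffunP => k; rewrite !ffunE.
rewrite (reindex f (onW_bij _ f_bij)); apply: eq_bigr => h _.
apply: eq_bigr => k _; congr (g k _); rewrite /nth_copy /= !ffunE.
by case: (h k) => -[].
Qed.

(** On a product ket the double sum defining [tensor_power] factors over the copies, and each factor
    is an entry of [L] at the one-copy state. *)
Lemma tensor_power_proj n L psi phi : linear L ->
  L (proj (mkket psi)) = proj (mkket phi) ->
  tensor_power (n := n) L (proj (mkket (ket_power psi))) =
  proj (mkket (ket_power phi)).
Proof.
move=> L_lin L_psi; apply: op_ext => y y'; rewrite entry_mkop entry_proj.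
under eq_bigr => x _.
  under eq_bigr => x' _.
    rewrite entry_proj rmorph_prod -mulrA -big_split /=.
    over.
  rewrite -mulr_sumr.
  rewrite (sum_prod_copies (fun k s => (psi s)^* *
    entry (L (unit_op R (nth_copy x k) s)) (nth_copy y k) (nth_copy y' k))).
  rewrite -big_split.
  over.
rewrite /= (sum_prod_copies (fun k s => psi s * \sum_s' (psi s')^* *
    entry (L (unit_op R s s')) (nth_copy y k) (nth_copy y' k))).
rewrite rmorph_prod -big_split; apply: eq_bigr => k _.
transitivity (entry (proj (mkket phi)) (nth_copy y k) (nth_copy y' k)).
  rewrite -L_psi linear_entry //; apply: eq_bigr => s _.
  by rewrite mulr_sumr; apply: eq_bigr => s' _; rewrite entry_proj mulrA.
exact: entry_proj.
Qed.

End TensorPowers.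

(** * Pure outputs and total weights *)

Section PureOutput.
Local Open Scope sesquilinear_scope.
Variable R : realType.
Variables A B C A' B' C' : finType.
Implicit Types Q : kraus_form R A B C A' B' C'.

(** The images of [psi] under all operators of all branches decompose a rank-one operator, so each
    is a multiple of [phi]. *)
Lemma represents_pure Q (L : map3 R A B C A' B' C') psi phi :
  represents Q L -> L (proj psi) = proj phi -> phi != 0 ->
  exists2 alpha : forall t : branch Q, hidden t -> R[i],
    forall t (j : hidden t), kraus3 j *m psi = alpha t j *: phi
    & \sum_t \sum_j `|alpha t j| ^+ 2 = 1.
Proof.
move=> QL Lpsi phi0.
pose v (x : {t : branch Q & hidden t}) := kraus3 (tagged x) *m psi.
have [|alpha v_alpha sum1] := rank_one_decomposition (v := v) _ phi0.
  rewrite -[RHS]/(proj phi) -Lpsi QL sum_tagged; apply: eq_bigr => t _.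
  by apply: eq_bigr => j _; rewrite /v /= mul_sandwich_ket.
exists (fun t j => alpha (existT _ t j)).
  by move=> t j; rewrite -v_alpha.
by rewrite -sum1 sum_tagged.
Qed.

Lemma sqnorm_mul_delta m n (K : 'M[R[i]]_(m, n)) i :
  sqnorm (K *m delta_mx i 0 : 'cV_m) = \sum_x `|K x i| ^+ 2.
Proof. by rewrite -colE; apply: eq_bigr => x _; rewrite big_ord1 mxE. Qed.

Lemma sqnorm_delta n (i : 'I_n) : sqnorm (delta_mx i 0 : 'cV[R[i]]_n) = 1.
Proof.
rewrite /sqnorm (bigD1 i) //= [X in _ + X]big1 ?addr0 => [|j /negbTE ji].
  by rewrite big_ord1 mxE !eqxx normr1 expr1n.
by rewrite big_ord1 mxE ji normr0 expr0n.
Qed.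

(** Sum of the weight bound over all pairs of basis kets of Alice and Bob. *)
Lemma weight_AB_total Q w : weight_AB_le Q w ->
  \sum_(t : branch Q) sqnorm (krausA t) * sqnorm (krausB t) <=
  w * (#|A|%:R * #|B|%:R).
Proof.
move=> wQ.
have -> : w * (#|A|%:R * #|B|%:R) = \sum_(i < #|A|) \sum_(k < #|B|) w.
  by rewrite !sumr_const !card_ord -!mulrnA -natrM mulr_natr mulnC.
have -> : \sum_(t : branch Q) sqnorm (krausA t) * sqnorm (krausB t) =
    \sum_(i < #|A|) \sum_(k < #|B|) \sum_(t : branch Q)
      sqnorm (krausA t *m delta_mx i 0 : 'cV_#|{: A'}|)
        * sqnorm (krausB t *m delta_mx k 0 : 'cV_#|{: B'}|).
  under [RHS]eq_bigr do rewrite exchange_big.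
  rewrite exchange_big; apply: eq_bigr => t _ /=.
  rewrite /sqnorm exchange_big mulr_suml; apply: eq_bigr => i _ /=.
  rewrite exchange_big mulr_sumr; apply: eq_bigr => k _ /=.
  by rewrite -!sqnorm_mul_delta.
do 2!apply: ler_sum => ? _; apply: le_trans (wQ _ _) _.
by rewrite !sqnorm_delta !mulr1.
Qed.

End PureOutput.

(** Sum over pairs of equal basis kets only, the pairs occurring in GHZ; this costs one factor of
    the dimension instead of two. *)
Lemma weight_AB_diag (R : realType) (A C A' B' C' : finType)
    (Q : kraus_form R A A C A' B' C') w : weight_AB_le Q w ->
  \sum_(t : branch Q) \sum_i (\sum_x `|krausA t x i| ^+ 2) *
    (\sum_y `|krausB t y i| ^+ 2) <= w * #|A|%:R.
Proof.
move=> wQ; rewrite exchange_big /=.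
have -> : w * #|A|%:R = \sum_(i < #|A|) w.
  by rewrite sumr_const card_ord mulr_natr.
apply: ler_sum => i _; have := wQ (delta_mx i 0) (delta_mx i 0).
rewrite !sqnorm_delta !mulr1; apply: le_trans.
by apply: ler_sum => t _; rewrite !sqnorm_mul_delta.
Qed.

(** * Amplitudes of the [n]-copy kets *)

Section Amplitudes.
Variable R : realType.

Lemma prod_eq_copies (T : eqType) n (x y : copies n T) (c : R[i]) :
  \prod_k ((x k == y k)%:R / c) = (x == y)%:R / c ^+ n.
Proof.
rewrite big_split prodr_const card_ord exprVn; congr (_ / _).
have [->|/eqP xy] := eqVneq x y.
  by rewrite big1 // => k _; rewrite eqxx.
have [k /negbTE xyk] : exists k, x k != y k.
  apply/existsP; rewrite -negb_forall; apply/negP => /forallP xyE.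
  by apply: xy; apply/ffunP => k; apply/eqP.
by rewrite (bigD1 k) //= xyk mul0r.
Qed.

Definition zip_copies n (S T : Type) (x : copies n S) (y : copies n T) :
  copies n (S * T) := [ffun k => (x k, y k)].

Lemma ket_power_two_epr n (x y : copies n bool) w :
  ket_power (fun '(a, b, (c1, c2)) => epr R a c1 * epr R b c2) (x, y, w) =
  (w == zip_copies x y)%:R / sqrtC 2 ^+ n / sqrtC 2 ^+ n.
Proof.
have -> : (w == zip_copies x y)%:R / sqrtC 2 ^+ n / sqrtC 2 ^+ n =
   (zip_copies x y == w)%:R / (sqrtC 2 * sqrtC 2) ^+ n :> R[i].
  by rewrite eq_sym exprMn invfM mulrA.
rewrite -prod_eq_copies; apply: eq_bigr => k _; rewrite /nth_copy /= !ffunE.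
case: (w k) => c1 c2; rewrite /epr xpair_eqE invfM mulrACA -natrM mulnb.
by rewrite mulrA.
Qed.

Lemma ket_power_ghz n (x y z : copies n bool) :
  ket_power (fun '(a, b, c) => ghz R a b c) (x, y, z) =
  ((x == y) && (y == z))%:R / sqrtC 2 ^+ n.
Proof.
have -> : (x == y) && (y == z) = (zip_copies x y == zip_copies y z).
  apply/andP/eqP => [[/eqP -> /eqP ->] //|/ffunP xyz].
  by split; apply/eqP/ffunP => k; have := xyz k; rewrite !ffunE => -[].
rewrite -prod_eq_copies; apply: eq_bigr => k _.
by rewrite !ffunE xpair_eqE /nth_copy /ghz.
Qed.

Lemma ket_power_epr n (x y : copies n bool) (z : copies n unit) :
  ket_power (fun '(a, b, _) => epr R a b) (x, y, z) = (x == y)%:R / sqrtC 2 ^+ n.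
Proof. by rewrite -prod_eq_copies. Qed.

End Amplitudes.

(** * Branch identities and contractivity in coordinates *)

Section PowerProtocols.
Local Open Scope sesquilinear_scope.
Variable R : realType.

Lemma power_protocol_kraus (A B C A' B' C' : finType) n
    (L : map3 R A B C A' B' C') psi phi
    (p : protocol R (copies n A') (copies n B') (copies n C')
                    (copies n A) (copies n B) (copies n C)) :
  linear L -> L (proj (mkket psi)) = proj (mkket phi) ->
  mkket (ket_power (n := n) phi) != 0 -> implements p (tensor_power L) ->
  exists Q : kraus_form R _ _ _ _ _ _,
  exists alpha : forall t : branch Q, hidden t -> R[i],
  [/\ contractive_C Q, weight_AB_le Q (2 ^+ bits_from_C p),
      \sum_t \sum_j `|alpha t j| ^+ 2 = 1
    & forall t (j : hidden t), kraus3 j *m mkket (ket_power (n := n) psi) =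
        alpha t j *: mkket (ket_power (n := n) phi)].
Proof.
move=> L_lin L_psi phi0 pL; have [Q [Qp Q_contr Q_weight]] := protocol_kraus_form p.
have [|alpha alphaE sum1] :=
    represents_pure (psi := mkket (ket_power (n := n) psi)) Qp _ phi0.
  by rewrite pL; apply: tensor_power_proj.
by exists Q, alpha.
Qed.

Lemma kraus3_ketE (A B C A' B' C' : finType) (Q : kraus_form R A B C A' B' C')
    (t : branch Q) (j : hidden t) psi x y z :
  (kraus3 j *m mkket psi) (enum_rank (x, y, z)) 0 =
  \sum_i \sum_k \sum_w krausA t (enum_rank x) i * krausB t (enum_rank y) k *
    krausC j (enum_rank z) (enum_rank w) * psi (enum_val i, enum_val k, w).
Proof.
rewrite mxE (sum_enum_rank (C := R[i])) sum_triple.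
rewrite [RHS](sum_enum_rank (C := R[i])); apply: eq_bigr => i _.
rewrite [RHS](sum_enum_rank (C := R[i])); apply: eq_bigr => k _.
by apply: eq_bigr => w _; rewrite /kraus3 kprodE mxE !enum_rankK.
Qed.

(** Keeping a single coordinate [z] of Charlie's output only drops nonnegative terms. *)
Lemma contractive_C_row (A B C A' B' C' : finType) (Q : kraus_form R A B C A' B' C')
    (t : branch Q) z (v : C -> R[i]) : contractive_C Q ->
  \sum_(j : hidden t) `|\sum_w krausC j z (enum_rank w) * v w| ^+ 2 <=
  \sum_w `|v w| ^+ 2.
Proof.
move=> /(_ t (\col_i v (enum_val i))); rewrite [leRHS](sum_enum_rank (C := R[i])).
under [leRHS]eq_bigr do rewrite big_ord1 mxE enum_rankK.
apply: le_trans; apply: ler_sum => j _.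
rewrite /sqnorm (bigD1 z) //= big_ord1 mxE (sum_enum_rank (C := R[i])).
under [X in _ <= `|X| ^+ 2 + _]eq_bigr do rewrite mxE enum_rankK.
by rewrite lerDl; do 2!apply: sumr_ge0 => ? _; apply: exprn_ge0.
Qed.

Lemma sum_enum_val (X : finType) (f : X -> R[i]) :
  \sum_x f x = \sum_(i < #|{: X}|) f (enum_val i).
Proof.
by rewrite (sum_enum_rank (C := R[i])); apply: eq_bigr => x _; rewrite enum_rankK.
Qed.

Lemma sum_zip_copies n (X Y : finType) (f : copies n (X * Y) -> R[i]) :
  \sum_w f w = \sum_(i < #|copies n X|) \sum_(k < #|copies n Y|)
    f (zip_copies (enum_val i) (enum_val k)).
Proof.
rewrite -(sum_enum_val (fun x => \sum_k f (zip_copies x (enum_val k)))).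
under [RHS]eq_bigr => x _.
  rewrite -(sum_enum_val (fun y => f (zip_copies x y))).
  over.
rewrite pair_bigA /=.
rewrite (reindex (fun xy => zip_copies xy.1 xy.2)) //.
apply: onW_bij; exists (fun w : copies n (X * Y) =>
    ([ffun k => (w k).1], [ffun k => (w k).2])).
  by move=> [x y]; congr (_, _); apply/ffunP => k; rewrite !ffunE.
by move=> w; apply/ffunP => k; rewrite !ffunE; case: (w k).
Qed.

(** The EPR pairs force Charlie's label to be the zip of Alice's and Bob's, leaving one term for
    each [i] and [k]. *)
Lemma sum_two_epr n (X := copies n bool)
    (K : 'I_#|{: X}| -> 'I_#|{: X}| -> _ -> R[i]) :
  \sum_i \sum_k \sum_w K i k w *
    ket_power (fun '(a, b, (c1, c2)) => epr R a c1 * epr R b c2)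
      (enum_val i, enum_val k, w) =
  (\sum_i \sum_k K i k (zip_copies (enum_val i) (enum_val k)))
    / sqrtC 2 ^+ n / sqrtC 2 ^+ n.
Proof.
rewrite !mulr_suml; apply: eq_bigr => i _.
rewrite !mulr_suml; apply: eq_bigr => k _.
rewrite (bigD1 (zip_copies (enum_val i) (enum_val k))) //= big1 ?addr0.
  by rewrite ket_power_two_epr eqxx mul1r mulrA.
by move=> w /negbTE wN; rewrite ket_power_two_epr wN !mul0r mulr0.
Qed.

Lemma contractive_C_zip n (X Y Z A B A' B' : finType)
    (Q : kraus_form R A B (copies n (X * Y)%type) A' B' Z) (t : branch Q) z
    (v : 'M[R[i]]_(#|copies n X|, #|copies n Y|)) : contractive_C Q ->
  \sum_(j : hidden t) `|\sum_i \sum_k krausC j z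
     (enum_rank (zip_copies (enum_val i) (enum_val k))) * v i k| ^+ 2 <= sqnorm v.
Proof.
move=> Q_contr.
pose u (w : copies n (X * Y)) :=
  v (enum_rank [ffun k => (w k).1]) (enum_rank [ffun k => (w k).2]).
have u_zip i k : u (zip_copies (enum_val i) (enum_val k)) = v i k.
  by congr (v _ _); apply: enum_val_inj; rewrite enum_rankK; apply/ffunP => l;
     rewrite !ffunE.
have := contractive_C_row t z u Q_contr; congr (_ <= _).
  apply: eq_bigr => j _; rewrite sum_zip_copies; congr (`|_| ^+ 2).
  by do 2![apply: eq_bigr => ? _]; rewrite u_zip.
by rewrite sum_zip_copies; do 2![apply: eq_bigr => ? _]; rewrite u_zip.
Qed.

Lemma sqrt2X_neq0 n : sqrtC 2 ^+ n != 0 :> R[i].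
Proof. by rewrite expf_neq0 // sqrtC_eq0 pnatr_eq0. Qed.

Lemma norm_sqrt2X n : `|sqrtC 2 ^+ n| ^+ 2 = 2 ^+ n :> R[i].
Proof. by rewrite normrX ger0_norm ?sqrtC_ge0 ?ler0n // exprAC sqrtCK. Qed.

Lemma natr_card_copies_bool n : #|{: copies n bool}|%:R = 2 ^+ n :> R[i].
Proof. by rewrite card_ffun card_bool card_ord natrX. Qed.

End PowerProtocols.

(** * Counting the bits *)

Section BitBounds.
Local Open Scope sesquilinear_scope.
Variable R : realType.

Lemma mkket_neq0 (X : finType) (psi : X -> R[i]) x : psi x != 0 -> mkket psi != 0.
Proof.
apply: contraNneq => /(congr1 (fun M : 'cV_#|X| => M (enum_rank x) 0)).
by rewrite !mxE enum_rankK => ->.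
Qed.

Lemma sqnorm_tr m n (M : 'M[R[i]]_(m, n)) : sqnorm M^T = sqnorm M.
Proof.
by rewrite /sqnorm exchange_big; do 2![apply: eq_bigr => ? _]; rewrite mxE.
Qed.

(** Charlie's row, reshaped into a square matrix, stands between [krausA t] and the transpose of
    [krausB t], and the product is scalar by the EPR output. *)
Lemma es_bits n (L : map3 R bool bool (bool * bool)%type bool bool unit)
    (p : protocol R (copies n bool) (copies n bool) (copies n unit)
       (copies n bool) (copies n bool) (copies n (bool * bool)%type)) :
  linear L -> L (proj (two_epr_ABC R)) = proj (epr_AB R) ->
  implements p (tensor_power L) -> (2 * n <= bits_from_C p)%N.
Proof.
move=> L_lin L_epr pL; have s0 := sqrt2X_neq0 R n.
have [|Q [alpha [Q_contr Q_weight sum1 alphaE]]] :=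
    power_protocol_kraus L_lin L_epr _ pL.
  apply: (mkket_neq0 (x := ([ffun=> false], [ffun=> false], [ffun=> tt]))).
  by rewrite ket_power_epr eqxx mul1r invr_neq0.
have d_gt0 : 0 < 2 ^+ n :> R[i] by rewrite exprn_gt0 ?ltr0n.
have branch_bound (t : branch Q) : (\sum_j `|alpha t j| ^+ 2) * (2 ^+ n) ^+ 4 <=
    sqnorm (krausA t) * sqnorm (krausB t).
  pose z0 := enum_rank ([ffun=> tt] : copies n unit).
  pose c (j : hidden t) : 'M_#|{: copies n bool}| := \matrix_(i, k)
    krausC j z0 (enum_rank (zip_copies (enum_val i) (enum_val k))).
  (* The input carries two factors [1 / sqrtC 2 ^+ n] and the output one, so [alpha] is rescaled by
     [sqrtC 2 ^+ n]; its squared norm turns the cube of the dimension into a fourth power. *)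
  have := @scalar_sandwich_bound _ _ _ (krausA t) (krausB t)^T c
    (fun j => alpha t j * sqrtC 2 ^+ n).
  under eq_bigr do rewrite normrM exprMn norm_sqrt2X.
  rewrite -mulr_suml natr_card_copies_bool sqnorm_tr -mulrA -exprS; apply.
    move=> j; apply: matrix_rankP => x y.
    have := congr1 (fun M : 'cV_#|{: copies n bool * copies n bool
      * copies n unit}| => M (enum_rank (x, y, [ffun=> tt])) 0) (alphaE t j).
    rewrite kraus3_ketE sum_two_epr !mxE enum_rankK ket_power_epr.
    move/(canRL (divfK s0))/(canRL (divfK s0)); rewrite (inj_eq enum_rank_inj).
    rewrite mulrA (divfK s0) mulr_natr -mulrnAl => <-.
    rewrite exchange_big; apply: eq_bigr => k _; rewrite !mxE mulr_suml.
    by apply: eq_bigr => i _; rewrite mxE mulrAC.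
  move=> v; have := contractive_C_zip t z0 v Q_contr; congr (_ <= _).
  apply: eq_bigr => j _; congr (`|_| ^+ 2).
  by do 2![apply: eq_bigr => ? _]; rewrite mxE.
have := weight_AB_total Q_weight; rewrite natr_card_copies_bool => total.
have : (2 ^+ n) ^+ 4 <= 2 ^+ bits_from_C p * (2 ^+ n * 2 ^+ n) :> R[i].
  apply: le_trans total; rewrite -[leLHS]mul1r -[X in X * _ <= _]sum1 mulr_suml.
  by apply: ler_sum => t _; apply: branch_bound.
rewrite -exprD -!exprM -exprD ler_eXn2l ?ltr1n //.
lia.
Qed.

Lemma sum_ghz n (X := copies n bool)
    (K : 'I_#|{: X}| -> 'I_#|{: X}| -> _ -> R[i]) :
  \sum_i \sum_k \sum_w K i k w *
    ket_power (fun '(a, b, c) => ghz R a b c) (enum_val i, enum_val k, w) =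
  (\sum_i K i i (enum_val i)) / sqrtC 2 ^+ n.
Proof.
rewrite mulr_suml; apply: eq_bigr => i _.
rewrite (bigD1 i) //= [X in _ + X]big1 ?addr0 => [|k /negbTE ki]; last first.
  apply: big1 => w _; rewrite ket_power_ghz (inj_eq enum_val_inj) eq_sym ki.
  by rewrite mul0r mulr0.
rewrite (bigD1 (enum_val i)) //= big1 ?addr0 => [|w /negbTE wi].
  by rewrite ket_power_ghz !eqxx mul1r.
by rewrite ket_power_ghz eqxx eq_sym wi mul0r mulr0.
Qed.

(** Only the output entries with three equal labels are compared; the rescaling by [sqrtC 2 ^+ n] is
    as for entanglement swapping. *)
Lemma two_epr_ghz_bits n (L : map3 R bool bool (bool * bool)%type bool bool bool)
    (p : protocol R (copies n bool) (copies n bool) (copies n bool)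
       (copies n bool) (copies n bool) (copies n (bool * bool)%type)) :
  linear L -> L (proj (two_epr_ABC R)) = proj (ghz_ABC R) ->
  implements p (tensor_power L) -> (n <= bits_from_C p)%N.
Proof.
move=> L_lin L_ghz pL; have s0 := sqrt2X_neq0 R n.
have [|Q [alpha [Q_contr Q_weight sum1 alphaE]]] :=
    power_protocol_kraus L_lin L_ghz _ pL.
  apply: (mkket_neq0 (x := ([ffun=> false], [ffun=> false], [ffun=> false]))).
  by rewrite ket_power_ghz eqxx mul1r invr_neq0.
have d_gt0 : 0 < 2 ^+ n :> R[i] by rewrite exprn_gt0 ?ltr0n.
have branch_bound (t : branch Q) : (\sum_j `|alpha t j| ^+ 2) * (2 ^+ n) ^+ 3 <=
    sqnorm (krausA t) * sqnorm (krausB t).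
  have := @two_epr_ghz_branch _ _ _ (krausA t) (krausB t)
    (fun (j : hidden t) l i k =>
       krausC j l (enum_rank (zip_copies (enum_val i) (enum_val k))))
    (fun j => alpha t j * sqrtC 2 ^+ n).
  under eq_bigr do rewrite normrM exprMn norm_sqrt2X.
  rewrite -mulr_suml natr_card_copies_bool -mulrA -exprS; apply.
    move=> j l; rewrite -(enum_valK l); move: (enum_val l) => x.
    have := congr1 (fun M : 'cV_#|{: copies n bool * copies n bool
      * copies n bool}| => M (enum_rank (x, x, x)) 0) (alphaE t j).
    rewrite kraus3_ketE sum_two_epr !mxE enum_rankK ket_power_ghz !eqxx.
    move/(canRL (divfK s0))/(canRL (divfK s0)).
    by rewrite mulrA (divfK s0) mulr1.
  by move=> l v; exact: contractive_C_zip.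
have := weight_AB_total Q_weight; rewrite natr_card_copies_bool => total.
have : (2 ^+ n) ^+ 3 <= 2 ^+ bits_from_C p * (2 ^+ n * 2 ^+ n) :> R[i].
  apply: le_trans total; rewrite -[leLHS]mul1r -[X in X * _ <= _]sum1 mulr_suml.
  by apply: ler_sum => t _; apply: branch_bound.
rewrite -exprD -!exprM -exprD ler_eXn2l ?ltr1n //.
lia.
Qed.

(** GHZ and EPR kets have the same normalisation, so [alpha] enters without rescaling, and the
    diagonal weight bound replaces the total one. *)
Lemma ghz_epr_bits n (L : map3 R bool bool bool bool bool unit)
    (p : protocol R (copies n bool) (copies n bool) (copies n unit)
       (copies n bool) (copies n bool) (copies n bool)) :
  linear L -> L (proj (ghz_ABC R)) = proj (epr_AB R) ->
  implements p (tensor_power L) -> (n <= bits_from_C p)%N.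
Proof.
move=> L_lin L_epr pL; have s0 := sqrt2X_neq0 R n.
have [|Q [alpha [Q_contr Q_weight sum1 alphaE]]] :=
    power_protocol_kraus L_lin L_epr _ pL.
  apply: (mkket_neq0 (x := ([ffun=> false], [ffun=> false], [ffun=> tt]))).
  by rewrite ket_power_epr eqxx mul1r invr_neq0.
have d_gt0 : 0 < 2 ^+ n :> R[i] by rewrite exprn_gt0 ?ltr0n.
have branch_bound (t : branch Q) : (\sum_j `|alpha t j| ^+ 2) * (2 ^+ n) ^+ 2 <=
    \sum_i (\sum_x `|krausA t x i| ^+ 2) * (\sum_y `|krausB t y i| ^+ 2).
  pose z0 := enum_rank ([ffun=> tt] : copies n unit).
  have := @ghz_epr_branch _ _ _ (krausA t) (krausB t)
    (fun (j : hidden t) i => krausC j z0 i) (alpha t).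
  rewrite natr_card_copies_bool; apply.
    move=> j x y; rewrite -(enum_valK x) -(enum_valK y).
    move: (enum_val x) (enum_val y) => {}x {}y.
    have := congr1 (fun M : 'cV_#|{: copies n bool * copies n bool
      * copies n unit}| => M (enum_rank (x, y, [ffun=> tt])) 0) (alphaE t j).
    rewrite kraus3_ketE sum_ghz !mxE enum_rankK ket_power_epr.
    move/(canRL (divfK s0)); rewrite mulrA (divfK s0) (inj_eq enum_rank_inj) => <-.
    by apply: eq_bigr => i _; rewrite enum_valK.
  move=> v; have := contractive_C_row t z0 (fun w => v (enum_rank w)) Q_contr.
  rewrite -(sum_enum_rank (fun i => `|v i| ^+ 2)).
  under eq_bigr => j _.
    rewrite -(sum_enum_rank (fun i => krausC j z0 i * v i)).
    over.
  by [].
have := weight_AB_diag Q_weight; rewrite natr_card_copies_bool => total.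
have : (2 ^+ n) ^+ 2 <= 2 ^+ bits_from_C p * 2 ^+ n :> R[i].
  apply: le_trans total; rewrite -[leLHS]mul1r -[X in X * _ <= _]sum1 mulr_suml.
  by apply: ler_sum => t _; apply: branch_bound.
rewrite -!exprM -exprD ler_eXn2l ?ltr1n //.
lia.
Qed.

Lemma communication_cost_ge (A B C A' B' C' : finType)
    (L : map3 R A B C A' B' C') (m : nat) :
  (forall n (p : protocol R (copies n A') (copies n B') (copies n C')
                  (copies n A) (copies n B) (copies n C)),
     implements p (tensor_power L) -> (m * n <= bits_from_C p)%N) ->
  (m%:R%:E <= communication_cost L)%E.
Proof.
(* The bound on bits holds for every number of copies, so one instance suffices; [N.+1] is past the
   threshold and nonzero, which allows division by it. *)
move=> bits; apply/ereal_infP => _ [r [N /(_ N.+1 (leqnSn N))[p [pL p_le]]] <-].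
rewrite lee_fin -(ler_pM2r (ltr0Sn R N)) [leRHS]mulrC.
by apply: le_trans p_le; rewrite -natrM ler_nat; apply: bits.
Qed.

End BitBounds.

Theorem theorem2 (R : realType) :
  (* ES *)
  (forall (C' : finType)
     (L : map3 R qubit qubit (qubit * qubit)%type qubit qubit C'),
     es_box L -> (2%:E <= communication_cost (AB_output L))%E) /\
  (* 2EPR-GHZ *)
  (forall L : map3 R qubit qubit (qubit * qubit)%type qubit qubit qubit,
     two_epr_ghz_box L -> (1%:E <= communication_cost L)%E) /\
  (* GHZ-EPR *)
  (forall (C' : finType) (L : map3 R qubit qubit qubit qubit qubit C'),
     ghz_epr_box L -> (1%:E <= communication_cost (AB_output L))%E).
Proof.
split=> [C' L [L_locc L_epr] | ]; last split=> [L | C' L] [L_locc L_out].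
- apply: (communication_cost_ge (m := 2)) => n p.
  exact: es_bits (AB_output_linear (locc_linear L_locc)) L_epr.
- apply: (communication_cost_ge (m := 1)) => n p; rewrite mul1n.
  exact: two_epr_ghz_bits (locc_linear L_locc) L_out.
- apply: (communication_cost_ge (m := 1)) => n p; rewrite mul1n.
  exact: ghz_epr_bits (AB_output_linear (locc_linear L_locc)) L_out.
Qed.
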